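(* Let $G$ be a non-archimedean, Roelcke precompact Polish group acting continuously on a discrete space $X$. Suppose the action of $G$ on $X$ is amenable. Then $X$ contains a finite $G$-orbit.
   Context: A topological group is non-archimedean if it has a base of open neighbourhoods of the identity consisting of subgroups. A topological group $G$ is Roelcke precompact if for every open neighbourhood $U$ of the identity there is a finite set $E \subseteq G$ with $G = UEU$. An action of a group $G$ on a discrete space $X$ is amenable if there is a $G$-invariant finitely additive measure on $X$, i.e. a $G$-invariant finitely additive map $\mu$ from the set of all subsets of $X$ to $[0,1]$ with $\mu(X) = 1$. *)

(* Defs.v *)
From HB Require Import structures.
From mathcomp Require Import all_boot all_order all_algebra.
From mathcomp Require Import all_classical all_reals all_analysis.

Set Implicit Arguments.
Unset Strict Implicit.
Unset Printing Implicit Defensive.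

Import Order.TTheory GRing.Theory Num.Theory.

Local Open Scope classical_set_scope.
Local Open Scope group_scope.

HB.mixin Record isTopologicalGroup G & Topological G & Group G := {
  mulg_continuous : continuous (fun p : (G * G)%type => p.1 * p.2) ;
  invg_continuous : continuous (fun g : G => g^-1)
}.

#[short(type="topologicalGroupType")]
HB.structure Definition TopologicalGroup :=
  {G of Topological G & Group G & isTopologicalGroup G}.

(* Separable and completely metrizable, the latter stated as: homeomorphic to
   a metric space in which every Cauchy sequence converges. *)
Definition polish (R : realType) (T : topologicalType) : Prop :=
  (exists2 D : set T, countable D & dense D) /\
  (exists (M : metricType R) (f : T -> M) (f' : M -> T),
    [/\ cancel f f', cancel f' f, continuous f, continuous f' &
        forall u : nat -> M, cauchy (u @ \oo) -> exists l : M, u @ \oo --> l]).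

(* Members of B are neighbourhoods of 1 because [filter_from B id] contains
   them. *)
Definition non_archimedean (G : topologicalGroupType) : Prop :=
  exists2 B : set (set G),
    forall H, B H -> open H /\ group_closed (mem H) &
    nbhs (1 : G) = filter_from B id.

Definition roelcke_precompact (G : topologicalGroupType) : Prop :=
  forall U : set G, open_nbhs 1 U ->
    exists2 E : set G, finite_set E &
      [set: G] =
      [set x * v | x in [set u * e | u in U & e in E] & v in U].

Definition left_action (G : groupType) (X : Type) (act : G -> X -> X) : Prop :=
  (forall x, act 1 x = x) /\
  (forall g h x, act (g * h) x = act g (act h x)).

Definition continuous_action (G : topologicalGroupType) (X : topologicalType)
    (act : G -> X -> X) : Prop :=
  continuous (fun p : (G * X)%type => act p.1 p.2).

Definition action_orbit (G : groupType) (X : Type) (act : G -> X -> X)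
    (x : X) : set X := range (fun g => act g x).

Definition amenable_action (R : realType) (G : groupType) (X : Type)
    (act : G -> X -> X) : Prop :=
  exists mu : set X -> R,
    [/\ forall A, (0 <= mu A <= 1)%R,
        mu [set: X] = 1%R,
        forall A B, A `&` B = set0 -> mu (A `|` B) = (mu A + mu B)%R &
        forall g A, mu (act g @` A) = mu A].

(* Main.v *)
Require Import Defs.
From mathcomp Require Import all_boot all_order all_algebra.
From mathcomp Require Import all_classical all_reals all_analysis.

Set Implicit Arguments.
Unset Strict Implicit.
Unset Printing Implicit Defensive.

Import Order.TTheory GRing.Theory Num.Theory.

Local Open Scope classical_set_scope.
Local Open Scope group_scope.

(** Suppose that every orbit is infinite.  Two elements [t0] and [t1] of [G] are
built so that the graph on [X] with the edges [{y, t0 y}] and [{y, t1 y}] is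
sparse: its edges can be assigned to endpoints injectively.  There are twice
as many edges as points, so this is incompatible with an invariant mean.

Write [acl U] for the set of points with a finite [U]-orbit, the algebraic
closure of the open subgroup [U].  It grows as [U] shrinks, [acl G] is empty,
and every point lies in [acl U] as soon as [U] fixes it.  The elements [t0],
[t1] are limits of partial elements [(s, D)], standing for the coset [s D]: an
element of the coset maps [acl D] onto the closure of [s D s^-1].  Along a
decreasing sequence [W n] of open subgroups, stage [n] extends the partial
element of [t0], [t1], [t0^-1] or [t1^-1], according to [n] modulo 4, so that
its domain becomes [acl (W n)] and the points of [acl (W n)] that are new in the
domain are sent outside [acl (W n)].  The next subgroup [W n.+1] is then taken
so small that its closure contains these images.  Every edge appears at a
single stage [n], and it is assigned to its endpoint that has level [n], meaning
that it lies in [acl (W n.+1)] and not in [acl (W n)].  Hence for every [y]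
either [t0 y] has level 0 modulo 4 or [y] has level 2 modulo 4, and likewise
with [t1] and the levels 1 and 3 modulo 4.  An invariant mean would give measure
1 both to the set of points of even level and to the set of points of odd level.

Two facts make the construction possible.
- Extension ([acl_separation]): for open subgroups [W] of [U], some [u] in [U]
  moves every point of [acl W] outside [acl U] to a point outside [acl W].  By
  Roelcke precompactness only finitely many double cosets [W u W] matter, so
  finitely many points witness a failure, which contradicts P. M. Neumann's
  separation lemma for groups with infinite orbits ([neumann_separation]).
- Limits ([alternating_limit]): the cosets [s D] have a common element.  This is
  the completeness of a Polish group for its two-sided uniformity. *)

(** * Subgroups and their conjugates *)

Section Subgroups.
Context {G : groupType}.
Implicit Types (g h : G) (H K : set G).

Definition subgroup H :=
  [/\ H 1, forall x y, H x -> H y -> H (x * y) & forall x, H x -> H x^-1].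

Definition conj_set g H : set G := [set h | H (g^-1 * h * g)].

Lemma conj_setM g h H : conj_set (g * h) H = conj_set g (conj_set h H).
Proof. by apply/seteqP; split=> x; rewrite /conj_set /= invgM !mulgA. Qed.

Lemma conj_set1 H : conj_set 1 H = H.
Proof. by apply/seteqP; split=> x; rewrite /conj_set /= invg1 mul1g mulg1. Qed.

Lemma conj_setS g H K : H `<=` K -> conj_set g H `<=` conj_set g K.
Proof. by move=> HK x /HK. Qed.

Lemma subgroupT : subgroup setT. Proof. by []. Qed.

Lemma subgroupI H K : subgroup H -> subgroup K -> subgroup (H `&` K).
Proof.
move=> [H1 HM HV] [K1 KM KV]; split=> //.
- by move=> x y [? ?] [? ?]; split; [exact: HM|exact: KM].
- by move=> x [? ?]; split; [exact: HV|exact: KV].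
Qed.

Lemma subgroup_conj g H : subgroup H -> subgroup (conj_set g H).
Proof.
move=> [H1 HM HV]; split; rewrite /conj_set /=.
- by rewrite mulg1 mulVg.
- move=> x y Hx Hy; have := HM _ _ Hx Hy.
  by rewrite !mulgA mulgK.
- by move=> x /HV; rewrite !invgM invgK mulgA.
Qed.

Lemma subgroupMl H h g : subgroup H -> H h -> H (h * g) <-> H g.
Proof.
move=> [_ HM HV] Hh; split=> [Hhg|/(HM _ _ Hh)//].
by rewrite -(mulKg h g); apply: HM => //; exact: HV.
Qed.

Lemma subgroupMr H h g : subgroup H -> H h -> H (g * h) <-> H g.
Proof.
move=> [_ HM HV] Hh; split=> [Hhg|Hg]; last exact: HM.
by rewrite -(mulgK h g); apply: HM => //; exact: HV.
Qed.

Lemma conj_set_id H g : subgroup H -> H g -> conj_set g H = H.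
Proof.
move=> sH Hg; have HVg : H g^-1 by case: sH => _ _; apply.
apply/seteqP; split=> x; rewrite /conj_set /=.
  by move=> /(subgroupMr _ sH Hg)/(subgroupMl _ sH HVg).
by move=> Hx; apply/(subgroupMr _ sH Hg)/(subgroupMl _ sH HVg).
Qed.

End Subgroups.

(** * Points with a finite orbit and Neumann's separation lemma *)

Section AlgebraicPoints.
Context {G : groupType} {X : choiceType} (act : G -> X -> X).
Hypothesis actP : left_action act.
Implicit Types (U W : set G) (x : X).

Let act1 x : act 1 x = x. Proof. exact: actP.1. Qed.
Let actM g h x : act (g * h) x = act g (act h x). Proof. exact: actP.2. Qed.

Lemma actK g : cancel (act g) (act g^-1).
Proof. by move=> x; rewrite -actM mulVg act1. Qed.

Definition orbit_of U x : set X := [set act u x | u in U].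

(** For the automorphism group of a countable structure and the pointwise
stabilizer [U] of a finite set, this is the algebraic closure of that set. *)
Definition acl U : set X := [set x | finite_set (orbit_of U x)].

Lemma acl_anti U W : W `<=` U -> acl U `<=` acl W.
Proof. by move=> WU x; apply: sub_finite_set => _ [w /WU Uw <-]; exists w. Qed.

Lemma acl_conj g U x : acl (conj_set g U) (act g x) <-> acl U x.
Proof.
have main h V y : acl V y -> acl (conj_set h V) (act h y).
  move=> /(finite_image (act h)); apply: sub_finite_set => _ [w Vw <-].
  exists (act (h^-1 * w * h) y); first by exists (h^-1 * w * h).
  by rewrite -!actM !mulgA mulgV mul1g.
split=> [/(main g^-1)|]; last exact: main.
by rewrite actK -conj_setM mulVg conj_set1.
Qed.

Lemma acl_act U u x : subgroup U -> U u -> acl U (act u x) <-> acl U x.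
Proof. by move=> sU Uu; rewrite -(acl_conj u U x) conj_set_id. Qed.

(** The elements of [U] that map [a] to [b] form a coset of the stabilizer of
[a], which has infinite index, so the statement says that [U] is not a finite
union of such cosets.  Induction on [A], for all finite [B] at once.  Suppose
that no element works for [a :: A], and take [y] in the orbit of [a] outside
[B]: the elements mapping [a] to [y] move some point of [A] into [B].  By
translation, every element that maps [a] into [B] moves some point of [A] into a
larger finite set, which contradicts the induction hypothesis for that set. *)
Lemma neumann_separation U (A : seq X) (B : set X) :
    subgroup U -> {in A, forall a, ~ acl U a} -> finite_set B ->
  exists2 u, U u & {in A, forall a, ~ B (act u a)}.
Proof.
move=> [U1 UM UV]; elim: A B => [|a A IH] B infA finB; first by exists 1.
have infa : ~ acl U a by apply: infA; rewrite mem_head.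
have [_ [[g Ug <-] nBga]] : exists y, (orbit_of U a `\` B) y.
  apply: contrapT => /forallNP sub; apply: infa; apply: sub_finite_set finB.
  by move=> y Uay; apply: contrapT => nBy; apply: (sub y).
(* [h y] carries [a] to [y], so [h y * g^-1] carries [act g a] to [y]. *)
have /choice[h hP] y : exists h, orbit_of U a y -> U h /\ act h a = y.
  have [[h Uh <-]|nUay] := pselect (orbit_of U a y); last by exists 1.
  by exists h.
pose C := B `|` \bigcup_(y in B) [set act (h y * g^-1) b | b in B].
have finC : finite_set C.
  rewrite finite_setU; split=> //; apply: bigcup_finite => // y _.
  exact: finite_image.
have [|u Uu uC] := IH C _ finC.
  by move=> b Ab; apply: infA; rewrite inE Ab orbT.
have [Bua|nBua] := pselect (B (act u a)); last first.
  exists u => // b; rewrite inE => /orP[/eqP->//|/uC nC].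
  by move=> Bub; apply: nC; left.
have [Uh ha] : U (h (act u a)) /\ act (h (act u a)) a = act u a.
  by apply: hP; exists u.
set k := h (act u a) in Uh ha.
(* This element maps [a] to [act g a], outside [B]. *)
exists (g * k^-1 * u); first by apply/UM => //; apply/UM => //; exact: UV.
move=> b; rewrite inE => /orP[/eqP->|/uC nC Bb].
  by rewrite 2!actM -ha actK.
apply: nC; right; exists (act u a) => //; eexists; first exact: Bb.
by rewrite -actM !mulgA mulgVK mulgV mul1g.
Qed.

End AlgebraicPoints.

(** * Open subgroups and Roelcke precompactness *)

Section OpenSubgroups.
Context {G : topologicalGroupType}.
Implicit Types (g h : G) (H K : set G).

Definition open_subgroup H := open H /\ subgroup H.

Lemma open_subgroupT : open_subgroup (setT : set G).
Proof. by split; [exact: openT|exact: subgroupT]. Qed.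

Lemma open_subgroupI H K :
  open_subgroup H -> open_subgroup K -> open_subgroup (H `&` K).
Proof. by move=> [? ?] [? ?]; split; [exact: openI|exact: subgroupI]. Qed.

Lemma continuous_mulgl g : continuous (fun x : G => g * x).
Proof.
move=> x; apply: (cvg_comp2 _ _ (mulg_continuous (g, x))).
- exact: cvg_cst.
- exact: cvg_id.
Qed.

Lemma continuous_mulgr g : continuous (fun x : G => x * g).
Proof.
move=> x; apply: (cvg_comp2 _ _ (mulg_continuous (x, g))).
- exact: cvg_id.
- exact: cvg_cst.
Qed.

Lemma open_subgroup_conj g H : open_subgroup H -> open_subgroup (conj_set g H).
Proof.
move=> [oH sH]; split; last exact: subgroup_conj.
apply: open_comp => // x _; apply: (@continuous_comp _ _ _ _ (fun y => y * g)).
- exact: continuous_mulgl.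
- exact: continuous_mulgr.
Qed.

Lemma open_subgroup_nbhs H : open_subgroup H -> nbhs (1 : G) H.
Proof. by move=> [oH [H1 _ _]]; apply: open_nbhs_nbhs. Qed.

Lemma non_archimedeanP (V : set G) : non_archimedean G -> nbhs (1 : G) V ->
  exists2 H, open_subgroup H & H `<=` V.
Proof.
move=> [B BP ->] [H BH HV]; exists H => //; have [oH gH] := BP H BH.
split=> //; split.
- by have := gH.1; rewrite inE.
- move=> x y Hx Hy; have := group_closedM gH (mem_set Hx) (mem_set Hy).
  by rewrite inE.
- by move=> x Hx; have := group_closedV gH (mem_set Hx); rewrite inE.
Qed.

(** Whether [u] sends some point of [acl W] outside [acl U] into [acl W] depends
only on the double coset [W u W].  If every [u] in [U] did, one bad point [x e]
for each of the finitely many representatives [e] would suffice, and the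
[W]-orbits of the points [x e] and [act e (x e)] would be finite sets that no
element of [U] separates. *)
Lemma acl_separation (X : choiceType) (act : G -> X -> X) U W :
    roelcke_precompact G -> left_action act ->
    subgroup U -> open_subgroup W -> W `<=` U ->
  exists2 u, U u & forall x, acl act W x -> ~ acl act U x ->
    ~ acl act W (act u x).
Proof.
move=> rG actP sU [oW sW] WU; have [W1 WM WV] := sW; have [U1 UM UV] := sU.
have [E finE GE] := rG W (conj oW W1).
apply: contrapT => noU.
have bad u : U u -> exists x, [/\ acl act W x, ~ acl act U x &
    acl act W (act u x)].
  move=> Uu; apply: contrapT => nx; apply: noU; exists u => // x ? ? ?.
  by apply: nx; exists x.
have [x0 _] := bad 1 U1.
have /choice[x xP] u : exists x, U u -> [/\ acl act W x, ~ acl act U x &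
    acl act W (act u x)].
  have [/bad[x xP]|nUu] := pselect (U u); last by exists x0.
  by exists x.
pose F := E `&` U.
have finF : finite_set F by exact: finite_setIl.
have [A AE] : exists A : seq X,
    \bigcup_(e in F) orbit_of act W (x e) = [set` A].
  apply/finite_seqP; apply: bigcup_finite => // e [_ Ue].
  by have [] := xP e Ue.
pose B := \bigcup_(e in F) orbit_of act W (act e (x e)).
have finB : finite_set B.
  by apply: bigcup_finite => // e [_ Ue]; have [] := xP e Ue.
have [a|u Uu uAB] := neumann_separation actP sU (A := A) _ finB.
  move=> aA; have : [set` A] a by [].
  rewrite -AE => -[e [_ Ue] [w Ww <-]].
  by move/(acl_act actP _ sU (WU _ Ww)); have [] := xP e Ue.
have : [set: G] u by []; rewrite GE => -[_ [w Ww [e Ee <-]]] [w' Ww' uE].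
have Ue : U e.
  apply/(subgroupMl e sU (WU _ Ww)); apply/(subgroupMr _ sU (WU _ Ww')).
  by rewrite uE.
apply: (uAB (act w'^-1 (x e))).
  suff : [set` A] (act w'^-1 (x e)) by [].
  by rewrite -AE; exists e => //; exists w'^-1 => //; exact: WV.
exists e => //; exists w => //.
by rewrite -uE -!actP.2 mulgK.
Qed.

End OpenSubgroups.

(** * Completeness of non-archimedean Polish groups *)

(** Separating the invariant [P] from the step relation, and letting the latter
depend on the stage, keeps proofs and counters out of the states. *)
Lemma dependent_choice_inv (T : Type) (P : T -> Prop)
    (S : nat -> T -> T -> Prop) (x0 : T) :
  P x0 -> (forall k x, P x -> exists2 y, P y & S k x y) ->
  exists f : nat -> T,
    [/\ f 0%N = x0, forall k, P (f k) & forall k, S k (f k) (f k.+1)].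
Proof.
move=> Px0 PS.
have /choice[F FP] (p : nat * T) :
    exists y, P p.2 -> P y /\ S p.1 p.2 y.
  have [/(PS p.1)[y Py Sy]|nP] := pselect (P p.2); last by exists x0.
  by exists y.
pose f := fix f k := if k is k'.+1 then F (k', f k') else x0.
have Pf k : P (f k) by elim: k => //= k IH; have [] := FP (k, f k) IH.
by exists f; split=> // k; have [] := FP (k, f k) (Pf k).
Qed.

Section Completeness.
Context {R : realType}.

(** Complete metrizability in a form that is convenient for recursive
constructions: each term of the sequence confines all the later ones. *)
Lemma polish_shrinking_nbhs (T : topologicalType) : polish R T ->
  exists N : nat -> T -> set T,
    [/\ forall k x, nbhs x (N k x),
        forall x U, nbhs x U -> exists k, N k x `<=` U &
        forall v : nat -> T, (forall k m, (k <= m)%N -> N k (v k) (v m)) ->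
          exists l : T, v @ \oo --> l].
Proof.
move=> [_ [M [f [f' [fK f'K cf cf' complM]]]]].
exists (fun k x => f @^-1` ball (f x) (k.+1%:R^-1 : R)%R); split.
- move=> k x; apply: cf; exact: nbhsx_ballx.
- move=> x U Ux.
  have : nbhs (f x) (f' @^-1` U) by apply: cf'; rewrite fK.
  rewrite -nbhs_ballE => -[e /= e0 eU].
  have [k ke] := ltr_add_invr e0.
  exists k => y /= xy; rewrite -(fK y); apply: eU.
  apply: le_ball xy.
  by move: ke; rewrite add0r; exact: ltW.
- move=> v vN; have [|l vl] := complM (f \o v).
    apply: cauchy_exP => e e0; have [k ke] := ltr_add_invr e0.
    exists (f (v k)); exists k => // m /= km.
    apply: le_ball (vN k m km).
    by move: ke; rewrite add0r; exact: ltW.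
  exists (f' l).
  have -> : v = f' \o (f \o v) by apply/funext => m /=; rewrite fK.
  by apply: cvg_comp vl _; exact: cf'.
Qed.

Lemma open_subgroup_base (G : topologicalGroupType) :
    polish R G -> non_archimedean G ->
  exists b : nat -> set G, (forall k, open_subgroup (b k)) /\
    forall U, nbhs (1 : G) U -> exists k, b k `<=` U.
Proof.
move=> /polish_shrinking_nbhs[N [N1 Nbase _]] naG.
have /choice[b bP] k : exists H : set G, open_subgroup H /\ H `<=` N k 1.
  by have [H] := non_archimedeanP naG (N1 k 1); exists H.
exists b; split=> [k|U /Nbase[k NU]]; first by have [] := bP k.
by exists k; apply: subset_trans NU; have [] := bP k.
Qed.

(** Open subgroups are closed, and so are their cosets. *)
Lemma coset_limit (G : topologicalGroupType) (H : set G) (v : nat -> G)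
    (l g : G) (k : nat) : open_subgroup H ->
  v @ \oo --> l -> (forall m, (k <= m)%N -> H (g^-1 * v m)) -> H (g^-1 * l).
Proof.
move=> [oH sH] vl gv; have [H1 HM HV] := sH.
have : nbhs l [set x | H (l^-1 * x)].
  apply: open_nbhs_nbhs; split; last by rewrite /= mulVg.
  by apply: open_comp => // x _; exact: continuous_mulgl.
move=> /vl[m _ lv]; have /= Hlv := lv _ (leq_maxl m k).
have := HM _ _ (gv _ (leq_maxr m k)) (HV _ Hlv).
by rewrite invgM invgK mulgA mulgK.
Qed.

(** Since [(u j.+1)^-1] lies in the coset [u j * E j], the sequence [u] follows
alternately a partial element and its inverse.  The conclusion is that the
elements [u j] with [j] even and [(u j)^-1] with [j] odd, a Cauchy sequence for
the two-sided uniformity, have a limit [t] in [G].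

A complete metric on [G] need not be invariant, so [t] is reached indirectly, as
the quotient of two limits in [G].  A sequence [x k] is built with
[x k.+1 = u m * x k], where [m = m k] increases with [k] and has the same
parity, together with decreasing open subgroups [V k] such that the coset
[x k * V k.+1] has small diameter.  The index [m] is chosen after [V k.+1],
large enough that [u m' * u m] moves [x k] only inside [x k * V k.+1] for the
next index [m'].  Hence the terms of even and of odd index converge, to [l0] and
[l1], and [t := l1 * l0^-1] satisfies [t * l0 = l1]. *)
Lemma alternating_limit (G : topologicalGroupType) (u : nat -> G)
    (E : nat -> set G) :
    polish R G -> non_archimedean G ->
    (forall j, open_subgroup (E j)) ->
    (forall U, nbhs (1 : G) U ->
      exists N, forall j, (N <= j)%N -> E j `<=` U) ->
    (forall j, E j ((u j)^-1 * (u j.+1)^-1)) ->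
    (forall j, conj_set (u j.+1) (E j.+1) `<=` E j) ->
  exists t, forall j, E j ((u j)^-1 * (if odd j then t^-1 else t)).
Proof.
move=> polG naG oE E1 uE EE.
have sE j : subgroup (E j) by have [] := oE j.
pose Q j := [set g | E j ((u j)^-1 * g)].
have QV j g : Q j.+1 g -> Q j g^-1.
  move=> Qg; have [_ EM _] := sE j; have [_ _ EV] := sE j.+1.
  have : E j (u j.+1 * g^-1).
    apply: EE; rewrite /conj_set /= mulKg -[_ * _]invgK invgM invgK.
    exact: EV.
  by move=> /(EM _ _ (uE j)); rewrite mulgA mulgVK.
have Q2 i j : Q (j + i.*2)%N `<=` Q j.
  elim: i => [|i IH] g; first by rewrite addn0.
  rewrite doubleS !addnS => /QV/QV; rewrite invgK; exact: IH.
have Qu j : Q j (u j) by rewrite /Q /= mulVg; have [] := sE j.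
have [N [Nn _ Nlim]] := polish_shrinking_nbhs polG.
have [b [ob b1]] := open_subgroup_base polG naG.
(* A state [(x, V, n)]: the elements of [u n * E n] agree on the coset [x V]. *)
pose P (s : G * set G * nat) :=
  open_subgroup s.1.2 /\ E s.2 `<=` conj_set s.1.1 s.1.2.
pose S k (s s' : G * set G * nat) :=
  [/\ s'.1.2 `<=` s.1.2, s'.1.2 `<=` b k,
      [set g | s'.1.2 (s.1.1^-1 * g)] `<=` N k./2 s.1.1 &
      exists i, let m := (s.2 + i.*2)%N in
        [/\ s'.2 = m.+1, s'.1.1 = u m * s.1.1 &
            E m `<=` conj_set s.1.1 s'.1.2]].
have [||f [f0 Pf Sf]] := @dependent_choice_inv _ P S (1, setT, 0%N).
- by split; [exact: open_subgroupT|].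
- move=> k [[x V] n] [/= oV EV].
  have [V0 oV0 V0N] : exists2 V0, open_subgroup V0 &
      [set g | V0 (x^-1 * g)] `<=` N k./2 x.
    have : nbhs (1 : G) [set v | N k./2 x (x * v)].
      by apply: (continuous_mulgl (g := x)); rewrite mulg1.
    move=> /(non_archimedeanP naG)[V0 oV0 V0N]; exists V0 => // g /= /V0N/=.
    by rewrite mulVKg.
  pose V1 := V `&` V0 `&` b k.
  have oV1 : open_subgroup V1.
    by apply: open_subgroupI => //; exact: open_subgroupI.
  have [N0 N0P] := E1 _ (open_subgroup_nbhs (open_subgroup_conj x oV1)).
  pose m := (n + N0.*2)%N.
  have EmV : E m `<=` conj_set x V1.
    by apply: N0P; rewrite /m -addnn addnA leq_addl.
  exists (u m * x, V1, m.+1).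
    split=> //= g; rewrite conj_setM => Eg; apply: EmV.
    have [_ EM' EV'] := sE m.
    have Eu : E m (u m.+1 * u m).
      by rewrite -[_ * _]invgK invgM; apply: EV'; exact: uE.
    have : E m (u m.+1 * g * (u m.+1)^-1).
      by apply: EE; rewrite /conj_set /= !mulgA mulVg mul1g mulgVK.
    move=> /(EM' _ _ (EV' _ Eu))/EM'/(_ Eu).
    by rewrite invgM !mulgA mulgVK mulgVK.
  split=> //=.
  - by move=> g [[]].
  - by move=> g [].
  - by move=> g /= [[_ /V0N]].
  - by exists N0.
pose x k := (f k).1.1; pose V k := (f k).1.2; pose n k := (f k).2.
pose m k := (n k.+1).-1.
have oV k : open_subgroup (V k) by have [] := Pf k.
have sV k : subgroup (V k) by have [] := oV k.
have VS k : V k.+1 `<=` V k by have [] := Sf k.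
have Vle i k : (i <= k)%N -> V k `<=` V i.
  by move=> /subnK <-; elim: (k - i)%N => // j IH g /VS/IH.
have VN k : [set g | V k.+1 ((x k)^-1 * g)] `<=` N k./2 (x k).
  by have [] := Sf k.
have xS k : x k.+1 = u (m k) * x k.
  by have [_ _ _ [i [nE xE _]]] := Sf k; rewrite /x /m /n nE xE.
have EV k : E (m k) `<=` conj_set (x k) (V k.+1).
  by have [_ _ _ [i [nE _]]] := Sf k; rewrite /m /n nE.
have nS k : n k.+1 = (m k).+1.
  by have [_ _ _ [i [nE _ _]]] := Sf k; rewrite /m /n nE.
have mE k : exists i, m k = (n k + i.*2)%N.
  by have [_ _ _ [i [nE _ _]]] := Sf k; exists i; rewrite /m /n nE.
have odd_n k : odd (n k) = odd k.
  elim: k => [|k IH]; first by rewrite /n f0.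
  by rewrite nS /=; have [i ->] := mE k; rewrite oddD odd_double addbF IH.
have le_n k : (k <= n k)%N.
  elim: k => // k IH; rewrite nS ltnS; have [i ->] := mE k.
  exact: leq_trans (leq_addr _ _).
(* Two steps apply [u m'] after [u m], and [u m'] is close to the inverse of
[u m]. *)
have x2 k : V k.+1 ((x k)^-1 * x k.+2).
  have Em : E (m k) (u (m k.+1) * u (m k)).
    have := Qu (m k.+1); have [i] := mE k.+1; rewrite nS => mk1.
    rewrite {1}mk1 => /Q2/QV; rewrite /Q /= => Eu.
    by rewrite -[_ * _]invgK invgM; have [_ _] := sE (m k); apply.
  by have := EV _ _ Em; rewrite /conj_set /= !xS !mulgA.
have x2i k i : V k.+1 ((x k)^-1 * x (k + i.*2)%N).
  elim: i => [|i IH]; first by rewrite addn0 mulVg; have [] := sV k.+1.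
  rewrite doubleS !addnS.
  have /(Vle k.+1) : V (k + i.*2).+1 ((x (k + i.*2)%N)^-1 * x (k + i.*2).+2).
    exact: x2.
  rewrite ltnS leq_addr => /(_ isT); have [_ VM _] := sV k.+1.
  by move=> /(VM _ _ IH); rewrite mulgA mulgK.
have limP e : (e < 2)%N -> exists l, forall i,
    V (e + i.*2).+1 ((x (e + i.*2)%N)^-1 * l).
  move=> e2; have x2le i j : (i <= j)%N ->
      V (e + i.*2).+1 ((x (e + i.*2)%N)^-1 * x (e + j.*2)%N).
    by move=> /subnKC <-; rewrite doubleD addnA; exact: x2i.
  have [i j ij|l xl] := Nlim (fun i => x (e + i.*2)%N).
    have := VN _ _ (x2le _ _ ij); rewrite halfD odd_double andbF doubleK.
    by case: e e2 {x2le} => [|[]].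
  exists l => i; apply: coset_limit xl _; first exact: oV.
  exact: x2le.
have [l0 l0P] := limP 0%N isT; have [l1 l1P] := limP 1%N isT.
pose t := l1 * l0^-1.
have Qt j : ~~ odd j -> Q j t.
  move=> ej.
  have [k bk] := b1 _ (open_subgroup_nbhs (open_subgroup_conj l0^-1 (oE j))).
  (* [K] is even, so that [x K] and [x K.+1] approach [l0] and [l1]. *)
pose i := maxn k j; pose K := i.*2.
  have iK : (i <= K)%N by rewrite /K -addnn leq_addl.
  have Qm : Q j (u (m K)).
    have jm : (j <= m K)%N.
      have [i' ->] := mE K; apply: leq_trans (leq_addr _ _).
      apply: leq_trans (le_n K); apply: leq_trans iK; exact: leq_maxr.
    have om : ~~ odd (m K - j).
      have [i' mK] := mE K; rewrite oddB// mK oddD odd_double addbF odd_n.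
      by rewrite /K odd_double.
    apply: (Q2 (m K - j)./2); rewrite even_halfK// subnKC//; exact: Qu.
  have Vb : V K.+1 `<=` b k.
    apply: (@subset_trans _ (V k.+1)); last by have [] := Sf k.
    apply: Vle; rewrite ltnS; apply: leq_trans iK; exact: leq_maxl.
  have [_ VM VV] := sV K.+1; have [_ EM _] := sE j.
  have w1 : V K.+1 ((x K)^-1 * l0) by exact: (l0P i).
  have w2 : V K.+1 ((x K)^-1 * (u (m K))^-1 * l1).
    by rewrite -invgM -xS; apply: VS; exact: (l1P i).
  have := bk _ (Vb _ (VM _ _ (VV _ w1) w2)).
  rewrite /conj_set /= => /(EM _ _ Qm).
  by rewrite /Q /t /= !invgM !invgK !mulgA !mulgK.
exists t => j; case: ifPn => [oj|/Qt//].
by apply: QV; apply: Qt; rewrite /= oj.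
Qed.

End Completeness.

(** * The two generators *)

Section Construction.
Context {R : realType} {G : topologicalGroupType}.
Context {X : discreteTopologicalType} (act : G -> X -> X).
Hypotheses (polG : polish R G) (naG : non_archimedean G).
Hypotheses (rG : roelcke_precompact G) (actP : left_action act).

Let actM g h x : act (g * h) x = act g (act h x). Proof. exact: actP.2. Qed.

(** The simultaneous construction of both generators.  The coset [s n * D n] is
the partial element treated at stage [n].  Its extension [(s n.+2)^-1 * W n] is
recorded through inverses, as the coset of [s n.+2] by the conjugate subgroup
[D n.+2].  Each partial element is thus turned around every time it is
extended, so that domain and range are exhausted alternately by one uniform
step, and even and odd stages build the two generators. *)
Lemma closure_tower : exists (s : nat -> G) (D W : nat -> set G),
  [/\ D 0%N = setT /\ D 1%N = setT,
      forall n, [/\ open_subgroup (W n), open_subgroup (D n), W n `<=` D n,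
                    W n.+1 `<=` W n & W n.+1 `<=` D n.+2],
      forall U, nbhs (1 : G) U -> exists n, W n `<=` U,
      forall n, D n ((s n)^-1 * (s n.+2)^-1) /\
                D n.+2 = conj_set (s n.+2)^-1 (W n) &
      forall n x, acl act (W n) x -> ~ acl act (D n) x ->
        ~ acl act (W n) (act (s n.+2)^-1 x)].
Proof.
have [b [ob b1]] := open_subgroup_base polG naG.
(* A state is made of the current partial element, of the one waiting for its
turn, and of the subgroup [W n]. *)
pose P (p : (G * set G) * (G * set G) * set G) :=
  [/\ open_subgroup p.2, open_subgroup p.1.1.2, open_subgroup p.1.2.2,
      p.2 `<=` p.1.1.2 & p.2 `<=` p.1.2.2].
pose S k (p q : (G * set G) * (G * set G) * set G) :=
  [/\ q.1.1 = p.1.2,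
      q.2 `<=` p.2 `&` b k,
      p.1.1.2 (p.1.1.1^-1 * q.1.2.1^-1),
      q.1.2.2 = conj_set q.1.2.1^-1 p.2 &
      forall x, acl act p.2 x -> ~ acl act p.1.1.2 x ->
        ~ acl act p.2 (act q.1.2.1^-1 x)].
have [||f [f0 Pf Sf]] :=
  @dependent_choice_inv _ P S ((1, setT), (1, setT), setT).
- by split=> //=; exact: open_subgroupT.
- move=> k [[[s D] [s' D']] W] [/= oW oD oD' WD WD'].
  (* The point [act (s * u) x] has to avoid [acl W], that is, [act u x] has to
  avoid the closure of [conj_set s^-1 W]. *)
  pose W1 := W `&` conj_set s^-1 W.
  have oW1 : open_subgroup W1.
    by apply: open_subgroupI => //; exact: open_subgroup_conj.
  have [|u Du usep] := acl_separation rG actP oD.2 oW1.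
    by apply: subset_trans WD => g [].
  have oC : open_subgroup (conj_set (s * u) W) by exact: open_subgroup_conj.
  exists ((s', D'), ((s * u)^-1, conj_set (s * u) W),
          W `&` conj_set (s * u) W `&` b k).
    split=> //=.
    + by apply: open_subgroupI => //; exact: open_subgroupI.
    + by move=> g [[/WD']].
    + by move=> g [[]].
  split=> //=.
  + by move=> g [[]].
  + by rewrite invgK mulKg.
  + by rewrite invgK.
  + move=> x Wx nDx; rewrite invgK actM => Wsux.
    apply: (usep x) => //; first by apply: acl_anti Wx => g [].
    apply: (@acl_anti _ _ _ (conj_set s^-1 W)); first by move=> g [].
    by rewrite -(actK actP s (act u x)); apply/acl_conj.
exists (fun n => (f n).1.1.1), (fun n => (f n).1.1.2), (fun n => (f n).2).
have fS n : (f n.+1).1.1 = (f n).1.2 by have [] := Sf n.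
split.
- by rewrite fS f0.
- move=> n; rewrite !fS; have [? ? ? ? ?] := Pf n; have [? ? ? ? ?] := Pf n.+1.
  by split=> //; have [_ WI _ _ _] := Sf n; move=> g /WI[].
- move=> U /b1[k bU]; exists k.+1; apply: subset_trans bU.
  by have [_ WI _ _ _] := Sf k; move=> g /WI[].
- by move=> n; rewrite !fS; have [] := Sf n.
- by move=> n; rewrite !fS; have [] := Sf n.
Qed.

Hypothesis act_cont : continuous_action act.
Hypothesis infinite_orbits : forall x, ~ finite_set (action_orbit act x).

Lemma stabilizer_nbhs x : nbhs (1 : G) [set g | act g x = x].
Proof.
have cx : (fun g => act g x) @ (1 : G) --> act 1 x.
  have := @act_cont (1, x).
  apply: (cvg_comp2 (f := id) (g := cst x) (h := act)).
  - exact: cvg_id.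
  - exact: cvg_cst.
apply: (cx [set x]); rewrite /= actP.1.
by apply: open_nbhs_nbhs; split=> //; exact: discrete_open.
Qed.

Lemma acl_setT x : ~ acl act setT x. Proof. exact: infinite_orbits. Qed.

(** One generator of the tower.  Let [z j] be the endpoint of the edge
[{y, t y}] on the domain side of the partial element [(u j, E j)], namely [y]
for [j] even and [t y] for [j] odd.  The edge is covered by this partial element
if [z j] lies in [acl (E j)].  It is not covered at first, because [acl G] is
empty, and it eventually is.  When it becomes covered, from [j] to [j.+1], the
endpoint [z j] is in [acl (F j)] outside [acl (E j)], so the separation property
puts [z j.+1] outside [acl (F j)]. *)
Lemma edges_climb (u : nat -> G) (E F : nat -> set G) :
    E 0%N = setT ->
    (forall j, [/\ open_subgroup (E j), open_subgroup (F j) & F j `<=` E j]) ->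
    (forall U, nbhs (1 : G) U ->
      exists N, forall j, (N <= j)%N -> F j `<=` U) ->
    (forall j, E j ((u j)^-1 * (u j.+1)^-1)) ->
    (forall j, E j.+1 = conj_set (u j.+1)^-1 (F j)) ->
    (forall j x, acl act (F j) x -> ~ acl act (E j) x ->
       ~ acl act (F j) (act (u j.+1)^-1 x)) ->
  exists t, forall y, exists j, let z := if odd j then y else act t y in
    acl act (E j.+1) z /\ ~ acl act (F j) z.
Proof.
move=> E0 oEF F1 uE EF sep.
have oE j : open_subgroup (E j) by have [] := oEF j.
have sE j : subgroup (E j) by have [] := oE j.
have sF j : subgroup (F j) by have [_ [_ ?] _] := oEF j.
have FE j : F j `<=` E j by have [] := oEF j.
have EFV j : conj_set (u j.+1) (E j.+1) = F j.
  by rewrite EF -conj_setM mulgV conj_set1.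
(* Two extensions are needed for the domain to shrink: one extends the domain,
the other one the range. *)
have E2F j : E j.+2 `<=` F j.
  rewrite EF -(EFV j) -(mulVKg (u j.+1) (u j.+2)^-1) conj_setM.
  apply: conj_setS.
  by rewrite -(conj_set_id (sE j.+1) (uE j.+1)); apply: conj_setS; exact: FE.
have E1 U : nbhs (1 : G) U -> exists N, forall j, (N <= j)%N -> E j `<=` U.
  move=> /F1[N FU]; exists N.+2 => -[|[|j]] // Nj.
  by apply: subset_trans (FU j Nj); exact: E2F.
have [j|t tE] := alternating_limit polG naG oE E1 uE; first by rewrite EFV.
pose tj j := if odd j then t^-1 else t.
have tjS j : tj j.+1 = (tj j)^-1.
  by rewrite /tj /=; case: (odd j); rewrite /= ?invgK.
(* The coset of the extension at stage [j] is [(u j.+1)^-1 * F j]. *)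
have Ftj j : F j (u j.+1 * tj j).
  have := tE j.+1; rewrite EF -/(tj _) tjS /conj_set /= invgK mulVKg => Ft.
  by rewrite -[_ * _]invgK invgM; have [_ _] := sF j; apply.
have Etj j : E j.+1 = conj_set (tj j) (F j).
  by rewrite -[tj j](mulKg (u j.+1)) conj_setM (conj_set_id (sF j)).
exists t => y.
pose z j := if odd j then act t y else y.
have zS j : z j.+1 = act (tj j) (z j).
  by rewrite /z /tj /=; case: (odd j) => //=; rewrite actK.
have [j Kj min_j] : exists2 j, acl act (E j) (z j) &
    forall i, (i < j)%N -> ~ acl act (E i) (z i).
  have [N EN] :=
    E1 _ (filterI (stabilizer_nbhs y) (stabilizer_nbhs (act t y))).
  have exK : exists j, `[< acl act (E j) (z j) >].
    exists N; apply/asboolP; apply: (@sub_finite_set _ _ [set z N]) => //.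
    by move=> _ [g /(EN _ (leqnn _))[gy gty] <-]; rewrite /z; case: ifP.
  case: (ex_minnP exK) => j /asboolP Kj min_j; exists j => // i ij /asboolP Ki.
  by have := min_j i Ki; rewrite leqNgt ij.
case: j Kj min_j => [|j] Kj min_j.
  by case: (acl_setT (x := z 0%N)); rewrite -E0.
exists j.
have -> : (if odd j then y else act t y) = z j.+1.
  by rewrite /z /=; case: (odd j).
split=> //; rewrite zS.
have Fz : acl act (F j) (z j).
  by move: Kj; rewrite zS Etj => /acl_conj; apply.
rewrite -[tj j](mulKg (u j.+1)) actM; apply: sep.
- by apply/(acl_act actP _ (sF j) (Ftj j)).
- by move/(acl_act actP _ (sE j) (FE _ _ (Ftj j))); exact: min_j.
Qed.

(** [A i] is the set of points whose level is congruent to [i] modulo 4.  At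
stages congruent to 0 and 2 the edges of [t0] appear, with [t0 y] respectively
[y] as the endpoint that receives the level; stages 1 and 3 do the same for
[t1]. *)
Lemma paradoxical_partition : exists (A : nat -> set X) (t0 t1 : G),
  [/\ forall i j y, A i y -> A j y -> i = j,
      forall y, A 0%N (act t0 y) \/ A 2%N y &
      forall y, A 1%N (act t1 y) \/ A 3%N y].
Proof.
have [s [D [W [[D0 D1] oDW W1 sD sep]]]] := closure_tower.
have Wle m n : (m <= n)%N -> W n `<=` W m.
  move=> /subnK <-; elim: (n - m)%N => // k IH; apply: subset_trans IH.
  by have [] := oDW (k + m)%N.
pose L n := acl act (W n.+1) `\` acl act (W n).
have L_inj m n y : L m y -> L n y -> m = n.
  have le k l : L k y -> L l y -> (k <= l)%N.
    move=> [_ nWk] [Wl _]; rewrite leqNgt; apply/negP => lk; apply: nWk.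
    exact: acl_anti (Wle _ _ lk) _ Wl.
  by move=> Lm Ln; apply/eqP; rewrite eqn_leq !le.
pose A i := [set y | exists2 n, L n y & n %% 4 = i].
have thread e : (e < 2)%N -> exists t, forall y, A e (act t y) \/ A e.+2 y.
  move=> e2.
  have [|||||j x|t tP] := @edges_climb (fun j => s (e + j.*2)%N)
      (fun j => D (e + j.*2)%N) (fun j => W (e + j.*2)%N).
  - by case: e e2 => [|[]].
  - by move=> j; have [] := oDW (e + j.*2)%N.
  - move=> U /W1[N WU]; exists N => j Nj; apply: subset_trans WU.
    apply: Wle; apply: leq_trans Nj _; rewrite -addnn addnA; exact: leq_addl.
  - by move=> j; rewrite doubleS !addnS; have [] := sD (e + j.*2)%N.
  - by move=> j; rewrite doubleS !addnS; have [] := sD (e + j.*2)%N.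
  - by rewrite doubleS !addnS; exact: sep.
  exists t => y; have [j] := tP y.
  set z := (if _ then _ else _); rewrite /= doubleS !addnS => -[Dz nWz].
  have Lz : L (e + j.*2)%N z.
    by split=> //; apply: acl_anti Dz; have [] := oDW (e + j.*2)%N.
  have jE : (e + j.*2) %% 4 = if odd j then e.+2 else e.
    rewrite -(odd_double_half j) oddD odd_double addbF oddb doubleD -!muln2.
    rewrite addnA -mulnA addnC (modnMDl _ _ 4).
    by move: (e) e2 => [|[|]]; case: (odd j).
  move: Lz jE; rewrite /z; case: (odd j) => Lz jE; [right|left];
  by exists (e + j.*2)%N.
have [t0 t0P] := thread 0%N isT; have [t1 t1P] := thread 1%N isT.
exists A, t0, t1; split=> // i j y [m Lm <-] [n Ln <-].
by rewrite (L_inj _ _ _ Lm Ln).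
Qed.

End Construction.

(** * The contradiction with an invariant mean *)

Lemma no_invariant_mean (R : realType) (G : groupType) (X : choiceType)
    (act : G -> X -> X) (A : nat -> set X) (t0 t1 : G) :
    left_action act ->
    (forall i j y, A i y -> A j y -> i = j) ->
    (forall y, A 0%N (act t0 y) \/ A 2%N y) ->
    (forall y, A 1%N (act t1 y) \/ A 3%N y) ->
  ~ amenable_action R act.
Proof.
move=> actP A_inj At0 At1 [mu [mu01 muT muU mu_inv]].
have mu_le B C : B `<=` C -> (mu B <= mu C)%R.
  move=> BC; rewrite -(setDUK BC) muU ?setDIK//.
  by rewrite lerDl; case/andP: (mu01 (C `\` B)).
have muU_le B C : (mu (B `|` C) <= mu B + mu C)%R.
  rewrite -(setDUK (@subsetUl _ B C)) muU ?setDIK// lerD2l; apply: mu_le.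
  by move=> x [[]].
have cover t i : (forall y, A i (act t y) \/ A i.+2 y) ->
    (1 <= mu (A i `|` A i.+2))%R.
  move=> tP; rewrite muU; last first.
    apply/seteqP; split=> // y [/A_inj h /h]/eqP.
    by rewrite -addn2 -[X in X == _]addn0 eqn_add2l.
  rewrite -(mu_inv t^-1 (A i)) -muT; apply: le_trans (muU_le _ _).
  apply: mu_le => y _; have [Aty|] := tP y; last by right.
  by left; exists (act t y) => //; rewrite actK.
have := lerD (cover _ _ At0) (cover _ _ At1).
rewrite -muU; last first.
  by apply/seteqP; split=> // y [[|] Ai [|] Aj]; have := A_inj _ _ _ Ai Aj.
by move=> /le_trans/(_ (proj2 (andP (mu01 _)))); rewrite gerDl ler10.
Qed.

Theorem corollary1p4 (R : realType) (G : topologicalGroupType)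
    (X : discreteTopologicalType) (act : G -> X -> X) :
  polish R G ->
  non_archimedean G ->
  roelcke_precompact G ->
  left_action act ->
  continuous_action act ->
  amenable_action R act ->
  exists x : X, finite_set (action_orbit act x).
Proof.
move=> polG naG rG actP act_cont amen; apply: contrapT => /forallNP inf.
have [A [t0 [t1 [A_inj At0 At1]]]] :=
  paradoxical_partition polG naG rG actP act_cont inf.
exact: no_invariant_mean actP A_inj At0 At1 amen.
Qed.
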